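(* There is an absolute constant $c>0$ such that the following holds. Let $\beta^*\in\mathbb R^d$, $\mathbf X\in\mathbb R^{n\times d}$ with i.i.d. $N(0,1)$ entries, and $\eta\in\mathbb R^n$ deterministic with $|\{i:|\eta_i|\le1\}|\ge\alpha n$ for some $\alpha\in(0,1]$; let $\mathbf y=\mathbf X\beta^*+\eta$. Let $\hat\beta$ be the output of the Coordinate-wise Median Algorithm on $(\mathbf y,\mathbf X)$. Then for any $0<\tau\le\alpha^2n$, \[\|\beta^*-\hat\beta\|^2\le\frac{d\,\tau}{\alpha^2n}\big(1+\|\beta^*\|^2\big)\] with probability at least $1-2\exp(\ln d-c\tau)$.
   Context: Coordinate-wise Median Algorithm on input $(y,X)\in\mathbb R^n\times\mathbb R^{n\times d}$: sample independent $w_i\sim N(0,1)$ and Rademacher signs $\sigma_i$, independent of everything else, and set $y'_i=\sigma_iy_i+w_i$, $X'_{i,\cdot}=\sigma_iX_{i,\cdot}$. For each $j\in[d]$ let $M_j=\{i:|X'_{ij}|\ge1/2\}$ and let $\hat\beta_j$ be the median of $\{y'_i/X'_{ij}:i\in M_j\}$. Output $\hat\beta=(\hat\beta_1,\dots,\hat\beta_d)$. *)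

(* Defs.v *)
From HB Require Import structures.
From mathcomp Require Import all_boot all_order all_algebra.
From mathcomp Require Import all_classical all_reals all_analysis.
From mathcomp Require Import Rstruct Rstruct_topology.
Set Implicit Arguments. Unset Strict Implicit. Unset Printing Implicit Defensive.
Import Order.TTheory GRing.Theory Num.Theory.
Local Open Scope classical_set_scope.
Local Open Scope ring_scope.

(* Mutual independence of a finite family of real random variables:
   for every finite subfamily J and measurable sets B_i,
   P(/\_{i in J} F_i in B_i) = prod_{i in J} P(F_i in B_i).
   (Probabilities are finite, so comparing real parts via [fine] is exact.) *)
Definition mutually_independent {R : realType} {d} {T : measurableType d}
  (P : probability T R) {I : finType} (F : I -> T -> R) : Prop :=
  forall (J : {set I}) (B : I -> set R), (forall i, measurable (B i)) ->
    fine (P [set t | forall i, i \in J -> B i (F i t)]) =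
    \prod_(i in J) fine (P (F i @^-1` B i)).

(* Median of a finite list of reals: the lower median (element of rank
   ceil(k/2) in sorted order, k = size); 0 on the empty list. *)
Definition median {R : realType} (s : seq R) : R :=
  if s is [::] then 0 else nth 0 (sort <=%R s) ((size s).-1./2).

(* Coordinate-wise Median Algorithm, given the internal randomness
   w (Gaussian noise) and sg (Rademacher signs). *)
Definition cw_median {R : realType} (n d : nat) (y : 'I_n -> R)
  (X : 'I_n -> 'I_d -> R) (w sg : 'I_n -> R) : 'I_d -> R :=
  fun j => median [seq (sg i * y i + w i) / (sg i * X i j)
                  | i <- enum 'I_n & 1 / 2 <= `|sg i * X i j|].

(* Main.v *)
Require Import Defs.
From HB Require Import structures.
From mathcomp Require Import all_boot all_order all_algebra.
From mathcomp Require Import all_classical all_reals all_analysis.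
From mathcomp Require Import Rstruct Rstruct_topology.
From mathcomp Require Import measurable_realfun ring lra zify.
Set Implicit Arguments.
Unset Strict Implicit.
Unset Printing Implicit Defensive.
Import Order.TTheory GRing.Theory Num.Theory.
Local Open Scope classical_set_scope.
Local Open Scope ring_scope.

(** For a fixed coordinate j the residuals V_i = y'_i sigma_i - beta_j X_ij are
    independent of the X_ij, and the estimate exceeds beta_j + s only if at
    least half of the indices i in M_j satisfy V_i / X_ij > s.  The symmetry
    of X_ij makes large positive and large negative ratios equally likely, so
    the expected margin of the vote "V_i / X_ij <= s" over its negation, among
    the i in M_j, is P(i in M_j, |V_i / X_ij| <= s).  It is never negative,
    and since V_i is Gaussian with mean eta_i and variance at most
    1 + |beta|^2, it is of order s / sqrt(1 + |beta|^2) when |eta_i| <= 1.  A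
    Chernoff bound for the sum of the n independent votes and a union bound
    over the 2d one-sided events conclude. *)

(** Mutual independence is given only for the single entries of [X], [w] and [sg], and only on
    product events, whereas the proof needs it for groups of them: X_ij against V_i, and the votes
    of different rows against each other. Passing to the sigma-algebras that such groups generate
    gives both. The rate comes from a bias that is linear in t at the threshold s = t sqrt(1 +
    |beta|^2). Let kappa be [normal_lower_const]. A row with |eta_i| <= 1 contributes at least
    kappa^2 t: one factor kappa for |X_ij| >= 1/2, one factor kappa t for the small residual. The
    vote total thus has mean at least alpha n kappa^2 t, against fluctuations of order sqrt n. The
    square of this mean over n is kappa^4 alpha^2 n t^2, so t = sqrt(tau / (alpha^2 n)) yields an
    exponent proportional to tau, with c = kappa^4 / 8. The condition tau <= alpha^2 n says t <= 1,
    the range in which the Gaussian mass is bounded below linearly in t. *)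

(** * Normal laws: translation, reflection, convolution, mass of short intervals *)

Section gaussian.
Context {R : realType}.
Local Notation mu := (@lebesgue_measure R).
Implicit Types (m s b c r x y : R) (A : set R).

Lemma lebesgue_measure_shift c A : measurable A ->
  pushforward mu (fun x : measurableTypeR R => x + c : measurableTypeR R) A
  = mu A.
Proof.
move=> mA.
have mc : measurable_fun [set: measurableTypeR R]
    (fun x : measurableTypeR R => x + c : measurableTypeR R).
  by apply: measurable_funD.
pose shift_mixin := isMeasurableFun.Build _ _ _ _ _ mc.
pose shift_mfun : {mfun measurableTypeR R >-> measurableTypeR R} :=
  HB.pack (fun x : measurableTypeR R => x + c : measurableTypeR R) shift_mixin.
apply/esym/(@lebesgue_measure_unique R (pushforward mu shift_mfun)) => //= _ [[a b]] _ <-.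
rewrite /pushforward (_ : _ @^-1` _ = `](a - c), (b - c)]%classic); last first.
  by apply/seteqP; split => x /=; rewrite !in_itv/= ltrBlDr lerBrDr.
rewrite !lebesgue_measure_itv/= !lte_fin ltrD2r; case: ifP => // _.
by congr EFin; ring.
Qed.

Lemma ge0_integral_shift c (f : R -> \bar R) A : measurable A ->
  measurable_fun setT f -> (forall x, (0 <= f x)%E) ->
  (\int[mu]_(x in (fun x => (x + c)%R) @^-1` A) f (x + c)%R = \int[mu]_(x in A) f x)%E.
Proof.
move=> mA mf f0.
pose sh : measurableTypeR R -> measurableTypeR R := fun x => x + c.
have msh : measurable_fun setT sh by apply: measurable_funD.
transitivity (\int[pushforward mu sh]_(x in A) f x)%E.
  rewrite ge0_integral_pushforward//.
  exact: measurable_funTS.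
by apply: eq_measure_integral => //= B mB BA; exact: lebesgue_measure_shift.
Qed.

Lemma normal_prob_shift m s c A : s != 0 -> measurable A ->
  normal_prob m s ((fun x => x + c) @^-1` A) = normal_prob (m + c) s A.
Proof.
move=> s0 mA; rewrite /normal_prob -(@ge0_integral_shift c _ A mA).
- apply: eq_integral => x _; rewrite !normal_pdfE// /normal_fun.
  by rewrite opprD addrACA subrr addr0.
- by apply/measurable_EFinP; exact: measurable_normal_pdf.
- by move=> x; rewrite lee_fin normal_pdf_ge0.
Qed.

Lemma normal_prob0_opp s A : s != 0 -> measurable A ->
  normal_prob 0 s (-%R @^-1` A) = normal_prob 0 s A.
Proof.
move=> s0 mA; rewrite /normal_prob.
transitivity (\int[pushforward mu (-%R : measurableTypeR R -> measurableTypeR R)]_(x in A)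
   (normal_pdf 0 s x)%:E)%E.
  rewrite ge0_integral_pushforward; first last.
  - by move=> x _; rewrite lee_fin normal_pdf_ge0.
  - by apply: measurable_funTS; apply/measurable_EFinP; exact: measurable_normal_pdf.
  - exact: mA.
  - exact: oppr_measurable.
  apply: eq_integral => x _; rewrite /= !normal_pdfE// /normal_fun.
  by rewrite !subr0 sqrrN.
by apply: eq_measure_integral => //= B mB BA; exact: lebesgue_measureN.
Qed.

(** The Radon-Nikodym derivative of the normal law and its density have the same integral over every
    measurable set, so they agree almost everywhere and one may replace the other. *)
Lemma integral_normal_prob m s (f : R -> \bar R) :
  (normal_prob m s).-integrable setT f ->
  (\int[normal_prob m s]_x f x = \int[mu]_x (f x * (normal_pdf m s x)%:E))%E.
Proof.
move=> If; have mf := measurable_int _ If.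
rewrite -(Radon_Nikodym_change_of_variables (normal_prob_dominates m s))//=.
apply: ae_eq_integral => //.
- apply: emeasurable_funM => //; apply: (measurable_int mu).
  by apply: Radon_Nikodym_integrable; exact: normal_prob_dominates.
- apply: emeasurable_funM => //=; apply/measurableT_comp => //=.
  exact: measurable_normal_pdf.
- apply: ae_eqe_mul2l => /=.
  rewrite Radon_NikodymE//=; first exact: normal_prob_dominates.
  move=> numu; case: cid => /= h [h1 h2 h3].
  apply: integral_ae_eq => //=.
  + by apply/measurableT_comp =>//; exact: measurable_normal_pdf.
  + by move=> E _ mE; rewrite -h3.
Qed.

Lemma normal_peakE s : 0 < s -> normal_peak s = (s * Num.sqrt (pi *+ 2))^-1.
Proof.
move=> s0; rewrite /normal_peak -mulrnAr sqrtrM ?sqr_ge0//.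
by rewrite sqrtr_sqr gtr0_norm.
Qed.

(* Completing the square in x. *)
Lemma normal_pdf_mul b s x y : 0 < s ->
  let v := Num.sqrt (s ^+ 2 + b ^+ 2) in
  normal_pdf (b * x) s y * normal_pdf 0 1 x =
  normal_pdf 0 v y * normal_pdf (b * y / v ^+ 2) (s / v) x.
Proof.
move=> s0 v.
have v2 : v ^+ 2 = s ^+ 2 + b ^+ 2.
  by rewrite sqr_sqrtr// addr_ge0// sqr_ge0.
have v0 : 0 < v by rewrite sqrtr_gt0 ltr_pwDl ?sqr_ge0// exprn_gt0.
have sv0 : 0 < s / v by rewrite divr_gt0.
rewrite !normal_pdfE ?gt_eqF// !normal_peakE// /normal_fun.
have s0' : s != 0 by rewrite gt_eqF.
have v0' : v != 0 by rewrite gt_eqF.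
have p0 : Num.sqrt (pi *+ 2) != 0 :> R.
  by rewrite gt_eqF// sqrtr_gt0 pmulrn_lgt0// pi_gt0.
rewrite mulrACA -exp.expRD [RHS]mulrACA -exp.expRD; congr (_ * expR _).
  by field; rewrite ?s0' ?v0' ?p0.
apply/eqP; rewrite -subr_eq0; apply/eqP.
have -> : - (y - b * x) ^+ 2 / (s ^+ 2 *+ 2) + - (x - 0) ^+ 2 / (1 ^+ 2 *+ 2) -
  (- (y - 0) ^+ 2 / (v ^+ 2 *+ 2) +
   - (x - b * y / v ^+ 2) ^+ 2 / ((s / v) ^+ 2 *+ 2)) =
  (v ^+ 2 - (s ^+ 2 + b ^+ 2)) * ((x ^+ 2 - y ^+ 2 / v ^+ 2) / (s ^+ 2 *+ 2)).
  by field; rewrite ?s0' ?v0'.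
by rewrite v2 subrr mul0r.
Qed.

Lemma measurable_normal_pdf2 b s A : s != 0 -> measurable A ->
  measurable_fun setT
    (fun z : R * R => ((\1_A z.2 * normal_pdf (b * z.1) s z.2)%:E : \bar R)).
Proof.
move=> s0 mA; apply/measurable_EFinP/measurable_funM.
  by apply: measurableT_comp => //; exact: measurable_indic.
under eq_fun do rewrite normal_pdfE//.
apply: measurable_funM => //.
apply: measurableT_comp => //; apply: measurable_funM => //.
apply: measurableT_comp => //; apply: measurable_funX.
apply: measurable_funB; first exact: measurable_snd.
by apply: measurable_funM => //; exact: measurable_fst.
Qed.

Lemma normal_probE m s A : measurable A ->
  normal_prob m s A = (\int[mu]_y (\1_A y * normal_pdf m s y)%:E)%E.
Proof.
move=> mA; rewrite /normal_prob integral_mkcond; apply: eq_integral => y _.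
by rewrite patchE indicE; case: ifP => _; rewrite ?mul1r ?mul0r.
Qed.

(** Tonelli lets x be integrated first. After completing the square, the dependence on x is a normal
    density of total mass 1, which leaves the centered density of variance s^2 + b^2 in y. *)
Lemma normal_prob_convolution b s A : 0 < s -> measurable A ->
  (\int[normal_prob 0 1]_x normal_prob (b * x)%R s A =
   normal_prob 0 (Num.sqrt (s ^+ 2 + b ^+ 2)) A)%E.
Proof.
move=> s0 mA; set v := Num.sqrt _.
have v0 : 0 < v by rewrite sqrtr_gt0 ltr_pwDl ?sqr_ge0// exprn_gt0.
have s0' : s != 0 by rewrite gt_eqF.
have mf := measurable_normal_pdf2 b s0' mA.
have mg : measurable_fun setT (fun x => normal_prob (b * x) s A).
  under eq_fun do rewrite normal_probE//.
  apply: (@measurable_fun_fubini_tonelli_F _ _ _ _ R mu _ mf) => z.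
  by rewrite lee_fin mulr_ge0 ?normal_pdf_ge0.
rewrite integral_normal_prob; last first.
  apply: (@le_integrable _ _ _ (normal_prob 0 1) setT measurableT _
    (EFin \o cst 1)) => //; last exact: finite_measure_integrable_cst.
  move=> x _ /=; rewrite gee0_abs ?measure_ge0//= normr1.
  exact: (@probability_le1 _ _ _ (normal_prob (b * x) s)).
pose f (z : R * R) : \bar R :=
  (\1_A z.2 * normal_pdf (b * z.1) s z.2 * normal_pdf 0 1 z.1)%:E.
have mpdf m c : measurable_fun setT (EFin \o normal_pdf m c).
  by apply/measurable_EFinP; exact: measurable_normal_pdf.
transitivity (\int[mu]_x \int[mu]_y f (x, y))%E.
  apply: eq_integral => x _; rewrite normal_probE// -ge0_integralZr//.
  - apply/measurable_EFinP/measurable_funM; first exact: measurable_indic.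
    exact: measurable_normal_pdf.
  - by move=> y _; rewrite lee_fin mulr_ge0 ?normal_pdf_ge0.
  - by rewrite lee_fin normal_pdf_ge0.
rewrite fubini_tonelli; first last.
- by move=> z; rewrite lee_fin !mulr_ge0 ?normal_pdf_ge0.
- apply/measurable_EFinP/measurable_funM; first by have /measurable_EFinP := mf.
  apply: (measurableT_comp (measurable_normal_pdf 0 1)); exact: measurable_fst.
rewrite normal_probE//; apply: eq_integral => y _.
under eq_integral => x _ do
  rewrite /f /= -mulrA (normal_pdf_mul b x y s0) mulrA EFinM.
rewrite ge0_integralZl.
- by rewrite integral_normal_pdf mule1.
- exact: measurableT.
- exact: mpdf.
- by move=> x _; rewrite lee_fin normal_pdf_ge0.
- by rewrite lee_fin mulr_ge0 ?normal_pdf_ge0.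
Qed.

(* exp (- (3 / 2)^2 / 2) / sqrt (2 pi): every point of the ball considered in
   [normal_prob_ball_ge] satisfies |x| <= 3 v / 2. *)
Definition normal_lower_const : R := (expR (9 / 8) * Num.sqrt (pi *+ 2))^-1.

Lemma normal_lower_const_gt0 : 0 < normal_lower_const.
Proof.
by rewrite invr_gt0 mulr_gt0 ?expR_gt0// sqrtr_gt0 pmulrn_lgt0// pi_gt0.
Qed.

(** The set is an interval of length [t * v] on which the density is at least
    [normal_lower_const / v]. Because of [1 <= v], the shift [c] is absorbed into the scale. *)
Lemma normal_prob_ball_ge v c t : 1 <= v -> `|c| <= 1 -> 0 <= t -> t <= 1 ->
  ((normal_lower_const * t)%:E <=
   normal_prob 0 v [set x | `|x + c| <= t * v / 2]%R)%E.
Proof.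
move=> v1 c1 t0 t1.
have v0 : 0 < v by rewrite (lt_le_trans _ v1).
have -> : [set x | `|x + c| <= t * v / 2]%R =
    `[- c - t * v / 2, - c + t * v / 2]%classic.
  by apply/seteqP; split => x /=; rewrite in_itv/= ler_norml => /andP[h1 h2];
    apply/andP; split; lra.
rewrite /normal_prob.
set I := [set` _]; apply: (@le_trans _ _ (\int[mu]_(x in I)
    (normal_lower_const / v)%:E)%E).
  rewrite /I.
  rewrite integral_cst//= lebesgue_measure_itv/=.
  have tv0 : 0 <= t * v by rewrite mulr_ge0// ltW.
  case: ifPn => [_|].
    rewrite -EFinD -EFinM lee_fin.
    rewrite (_ : _ / v * _ = normal_lower_const * t)//.
    by field; rewrite gt_eqF.
  rewrite lte_fin -leNgt => h; have : t * v = 0 by lra.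
  move/eqP; rewrite mulf_eq0 (gt_eqF v0) orbF => /eqP ->.
  by rewrite mulr0 mule0.
rewrite /I; apply: ge0_le_integral => //.
- move=> x _; rewrite lee_fin; apply: divr_ge0; last exact: ltW.
  exact: ltW normal_lower_const_gt0.
- by apply/measurable_EFinP/measurable_funTS; exact: measurable_normal_pdf.
move=> x /=; rewrite in_itv/= => /andP[h1 h2].
rewrite lee_fin normal_pdfE ?gt_eqF// normal_peakE// /normal_fun subr0.
rewrite /normal_lower_const invfM -expRN -mulrA -invfM mulrC (mulrC v).
rewrite ler_wpM2l//.
  by rewrite invr_ge0 mulr_ge0 ?sqrtr_ge0// ltW.
rewrite ler_expR mulNr lerN2 ler_pdivrMr ?pmulrn_lgt0 ?exprn_gt0//.
have xv : `|x| <= 3 / 2 * v.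
  rewrite ler_norml; move: c1; rewrite ler_norml => /andP[c1 c2].
  by apply/andP; split; nra.
have : `|x| ^+ 2 <= (3 / 2 * v) ^+ 2.
  by rewrite ler_sqr ?nnegrE// mulr_ge0// ltW.
by rewrite real_normK ?num_real//; lra.
Qed.

End gaussian.

(** * Independence of sigma-algebras generated by disjoint groups of variables *)

Section independence.
Context {R : realType} {d : measure_display} {T : measurableType d}.
Variables (P : probability T R) (I : finType) (F : I -> T -> R).
Hypothesis mF : forall i, measurable_fun setT (F i).

(** The pi-system on which [mutually_independent] speaks; it generates the sigma-algebra of the
    coordinates in [J]. *)
Definition cylinders (J : {set I}) : set (set T) :=
  [set A | exists2 B : I -> set R, (forall i, measurable (B i)) &
    A = [set t | forall i, i \in J -> B i (F i t)]].

Lemma measurable_finI (K : finType) (Q : pred K) (E : K -> set T) :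
  (forall k, measurable (E k)) -> measurable [set t | forall k, Q k -> E k t].
Proof.
move=> mE; rewrite (_ : [set t | _] = \bigcap_(k in [set k | Q k]) E k)//.
by apply: fin_bigcap_measurable => //; exact: finite_finset.
Qed.

Lemma measurable_forall (K : finType) (E : K -> set T) :
  (forall k, measurable (E k)) -> measurable [set t | forall k, E k t].
Proof.
move=> mE; rewrite (_ : [set t | _] = [set t | forall k, predT k -> E k t]).
  exact: measurable_finI.
by apply/seteqP; split => t /= h k; [move=> _|]; exact: h.
Qed.

Lemma cylinders_measurable J : cylinders J `<=` measurable.
Proof.
move=> _ [B mB ->]; apply: measurable_finI => i.
by have := mF i measurableT (mB i); rewrite setTI.
Qed.

Lemma cylinders_setI_closed J : setI_closed (cylinders J).
Proof.
move=> _ _ [B mB ->] [C mC ->]; exists (fun i => B i `&` C i).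
  by move=> i; exact: measurableI.
by apply/seteqP; split => t /= h; [move: h => [h1 h2] i iJ; split; auto|
  split => i iJ; have [] := h i iJ].
Qed.

Lemma cylindersT J : cylinders J setT.
Proof. by exists (fun=> setT) => //; apply/seteqP; split. Qed.

Lemma cylindersS (J J' : {set I}) :
  (J \subset J')%B -> cylinders J `<=` cylinders J'.
Proof.
move=> /fintype.subsetP JJ' _ [B mB ->].
exists (fun i => if i \in J then B i else setT); first by move=> i; case: ifP.
apply/seteqP; split => t /= h i iJ; first by case: ifPn => // /h.
by have := h i (JJ' i iJ); rewrite iJ.
Qed.

(** A copy of [T] with a smaller sigma-algebra: measurability on it expresses that a variable
    depends only on the coordinates in [J]. *)
Definition sigma_of (J : {set I}) := g_sigma_algebraType (cylinders J).

Lemma sigma_of_measurable J : <<s cylinders J >> `<=` @measurable d T.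
Proof.
by apply: smallest_sub (@cylinders_measurable J); exact: sigma_algebra_measurable.
Qed.

Lemma measurable_coord (J : {set I}) i : i \in J ->
  measurable_fun setT (F i : sigma_of J -> R).
Proof.
move=> iJ _ B mB; rewrite setTI; apply: sub_sigma_algebra.
exists (fun k => if k == i then B else setT); first by move=> k; case: ifP.
apply/seteqP; split => t /= h; last by have := h i iJ; rewrite eqxx.
by move=> k kJ; case: eqP => // ->.
Qed.

Hypothesis indF : mutually_independent P F.

Section groups.
Variables (K : finType) (J : K -> {set I}).
Hypothesis disjJ : forall k l, k != l -> [disjoint J k & J l]%B.

(** Disjointness merges the cylinders of all groups into one cylinder over the union, [C i] being
    the constraint from the only group that contains [i]. The hypothesis then applies to the union
    and to each group, and the products match. *)
Lemma independent_cylinders (E : K -> set T) :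
  (forall k, cylinders (J k) (E k)) ->
  fine (P [set t | forall k, E k t]) = \prod_k fine (P (E k)).
Proof.
move=> cE.
have /choice[B BE] : forall k, exists B : I -> set R,
    (forall i, measurable (B i)) /\
    E k = [set t | forall i, i \in J k -> B i (F i t)].
  by move=> k; have [B mB ->] := cE k; exists B.
pose C i := if [pick k | i \in J k] is Some k then B k i else setT.
have CE k i : i \in J k -> C i = B k i.
  move=> ik; rewrite /C; case: pickP => [l il|/(_ k)]; last by rewrite ik.
  have [->//|lk] := eqVneq l k.
  by have := disjJ lk; rewrite disjoint_subset => /fintype.subsetP/(_ i il); rewrite inE ik.
have mC i : measurable (C i).
  by rewrite /C; case: pickP => // k _; have [mB _] := BE k.
have -> : [set t | forall k, E k t] =
    [set t | forall i, i \in (\bigcup_k J k)%SET -> C i (F i t)].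
  apply/seteqP; split => t /= h.
    move=> i /bigcupP[k _ ik]; rewrite (CE k)//.
    by have := h k; have [_ ->] := BE k; exact.
  move=> k; have [_ ->] := BE k => /= i ik; rewrite -(CE k)//.
  by apply: h; apply/bigcupP; exists k.
rewrite indF// partition_disjoint_bigcup//=; apply: eq_bigr => k _.
by rewrite -indF//; congr (fine (P _)); have [_ ->] := BE k;
  apply/seteqP; split => t /= h i ik; [rewrite -(CE k)|rewrite (CE k)]; auto.
Qed.

(** Dynkin's argument, one group at a time: [s] lists the groups whose events range over the whole
    generated sigma-algebra, while those of the other groups are still cylinders. *)
Lemma independent_sigma (E : K -> set T) :
  (forall k, <<s cylinders (J k) >> (E k)) ->
  fine (P [set t | forall k, E k t]) = \prod_k fine (P (E k)).
Proof.
move=> sE.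
suff: forall s : seq K, forall E : K -> set T,
    (forall k, k \in s -> <<s cylinders (J k) >> (E k)) ->
    (forall k, k \notin s -> cylinders (J k) (E k)) ->
    fine (P [set t | forall k, E k t]) = \prod_k fine (P (E k)).
  by move=> H; apply: (H (enum K)); [move=> k _; exact: sE|move=> k; rewrite mem_enum].
elim=> [|k0 s IH] {sE}E sE cE; first by apply: independent_cylinders => k; exact: cE.
have [k0s|k0s] := boolP (k0 \in s).
  apply: IH => k ks; first by apply: sE; rewrite inE ks orbT.
  by apply: cE; rewrite inE negb_or ks andbT; apply: contraNneq ks => ->.
have mE k : measurable (E k).
  apply: (@sigma_of_measurable (J k)).
  have [/sE//|/cE] := boolP (k \in k0 :: s); exact: sub_sigma_algebra.
pose C := [set t | forall k, k != k0 -> E k t].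
have mC : measurable C by exact: measurable_finI.
have EC (A : set T) : [set t | forall k, (if k == k0 then A else E k) t] = A `&` C.
  apply/seteqP; split => t /=.
    move=> h; split; first by have := h k0; rewrite eqxx.
    by move=> k kk0; have := h k; rewrite (negbTE kk0).
  by move=> [At Ct] k; case: eqVneq => // /Ct.
pose c := \prod_(k | k != k0) fine (P (E k)).
have c0 : 0 <= c by apply: prodr_ge0 => k _; exact: fine_ge0.
have prodE (A : set T) :
    \prod_k fine (P (if k == k0 then A else E k)) = c * fine (P A).
  rewrite (bigD1 k0)//= eqxx mulrC; congr (_ * _).
  by apply: eq_bigr => k /negbTE ->.
have finP (A : set T) : measurable A -> (fine (P A))%:E = P A.
  by move=> mA; rewrite fineK// fin_num_measure.
(* As functions of [A] both sides are finite measures; the induction hypothesis makes them agree on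
   the cylinders of [J k0], a pi-system. *)
have key : forall A, <<s cylinders (J k0) >> A ->
    mrestr P mC A = mscale (NngNum c0) P A.
  apply: (@g_sigma_algebra_measure_unique _ _ _ _ (@cylinders_measurable (J k0))
    (fun=> setT)).
  - by move=> _; exact: cylindersT.
  - by apply/seteqP; split => // t _; exists 0%N.
  - exact: cylinders_setI_closed.
  - move=> A cA; have mA := cylinders_measurable cA.
    change (P (A `&` C) = (c%:E * P A)%E); rewrite -EC -finP; last first.
      by rewrite EC; exact: measurableI.
    rewrite IH.
    + by rewrite prodE EFinM finP.
    + move=> k ks; case: eqVneq => [kk0|_]; first by rewrite kk0 (negbTE k0s) in ks.
      by apply: sE; rewrite inE ks orbT.
    + move=> k ks; case: eqVneq => [->//|kk0]; apply: cE.
      by rewrite inE negb_or kk0.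
  - move=> _; change (P (setT `&` C) < +oo)%E.
    by rewrite setTI ltey_eq fin_num_measure.
have -> : [set t | forall k, E k t] = E k0 `&` C.
  rewrite -EC; apply/seteqP; split => t /= h k; last by have := h k; case: eqVneq => [->|].
  by case: eqVneq => [<-|_]; exact: h.
have : P (E k0 `&` C) = (c%:E * P (E k0))%E := key _ (sE k0 (mem_head _ _)).
move=> ->.
rewrite -finP// -EFinM/= -prodE; apply: eq_bigr => k _.
by case: eqVneq => [->|].
Qed.

End groups.
End independence.

(** * Joint laws of independent pairs *)

Section pairs.
Context {R : realType} {d : measure_display} {T : measurableType d}.
Variable P : probability T R.
Implicit Types U V : T -> R.

Definition indep_pair U V := forall A B : set R, measurable A -> measurable B ->
  (P (U @^-1` A `&` V @^-1` B) = P (U @^-1` A) * P (V @^-1` B))%E.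

Lemma independent_pair (I : finType) (F : I -> T -> R) (J1 J2 : {set I}) U V :
  (forall i, measurable_fun setT (F i)) -> mutually_independent P F ->
  [disjoint J1 & J2]%B ->
  measurable_fun setT (U : sigma_of F J1 -> R) ->
  measurable_fun setT (V : sigma_of F J2 -> R) -> indep_pair U V.
Proof.
move=> mF indF dJ mU mV A B mA mB.
pose J b := if b then J1 else J2.
pose E b := if b then U @^-1` A else V @^-1` B.
have dJb k l : k != l -> [disjoint J k & J l]%B.
  by case: k; case: l => //= _; rewrite disjoint_sym.
have sE k : <<s cylinders F (J k) >> (E k).
  case: k; rewrite /E /J.
    by have := mU measurableT _ mA; rewrite setTI.
  by have := mV measurableT _ mB; rewrite setTI.
have mE k : measurable (E k) by exact: (sigma_of_measurable mF (sE k)).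
have -> : U @^-1` A `&` V @^-1` B = [set t | forall k, E k t].
  apply/seteqP; split => t /=; first by case=> ? ? [].
  by move=> h; split; [exact: (h true)|exact: (h false)].
rewrite -[LHS]fineK; last first.
  rewrite fin_num_measure//; exact: measurable_forall.
rewrite (independent_sigma mF indF dJb)// big_bool EFinM.
by rewrite !fineK// fin_num_measure.
Qed.

Lemma law_pair U V (mu nu : probability (measurableTypeR R) R) (X : set (R * R)) :
  measurable_fun setT U -> measurable_fun setT V -> indep_pair U V ->
  (forall A, measurable A -> P (U @^-1` A) = mu A) ->
  (forall A, measurable A -> P (V @^-1` A) = nu A) ->
  measurable X -> P [set t | X (U t, V t)] = (mu \x nu)%E X.
Proof.
move=> mU mV UV lU lV mX.
pose UV_fun t : measurableTypeR R * measurableTypeR R := (U t, V t).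
have mUV : measurable_fun setT UV_fun by exact: measurable_fun_pair.
pose UV_mixin := isMeasurableFun.Build _ _ _ _ _ mUV.
pose UV_mfun : {mfun T >-> (measurableTypeR R * measurableTypeR R)%type} :=
  HB.pack UV_fun UV_mixin.
rewrite (@product_measure_unique _ _ _ _ _ mu nu (pushforward P UV_mfun))// => A B mA mB.
transitivity (P (U @^-1` A) * P (V @^-1` B))%E; first exact: UV.
by congr (_ * _)%E; [exact: lU|exact: lV].
Qed.

Lemma law_add_normal U V b s A : 0 < s ->
  measurable_fun setT U -> measurable_fun setT V -> indep_pair U V ->
  (forall A, measurable A -> P (U @^-1` A) = normal_prob 0 1 A) ->
  (forall A, measurable A -> P (V @^-1` A) = normal_prob 0 s A) ->
  measurable A ->
  P ((fun t => b * U t + V t) @^-1` A) =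
  normal_prob 0 (Num.sqrt (s ^+ 2 + b ^+ 2)) A.
Proof.
move=> s0 mU mV UV lU lV mA.
pose X := [set z : R * R | A (b * z.1 + z.2)].
have mX : measurable X.
  have mf : measurable_fun setT (fun z : R * R => b * z.1 + z.2).
    apply: measurable_funD; last exact: measurable_snd.
    by apply: measurable_funM => //; exact: measurable_fst.
  by have := mf measurableT _ mA; rewrite setTI.
have -> : (fun t => b * U t + V t) @^-1` A = [set t | X (U t, V t)] by [].
rewrite (@law_pair U V (normal_prob 0 1) (normal_prob 0 s))//.
transitivity (\int[normal_prob 0 1]_x normal_prob (b * x)%R s A)%E; last first.
  exact: normal_prob_convolution.
rewrite /product_measure1; apply: eq_integral => x _.
rewrite /comp.
(* The section at x is the translate of [A] by - b x, so its mass under the centered law is the mass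
   of [A] under mean b x. *)
rewrite -[b * x]add0r -normal_prob_shift ?gt_eqF//; congr (normal_prob _ _ _).
by apply/seteqP; split => y /=; rewrite /xsection/= inE /X/= addrC.
Qed.

(** [U] and [- U] have the same law and both are independent of [V], so both pairs have the same
    product law, whatever the law of [V]. *)
Lemma law_pair_opp U V (nu : probability (measurableTypeR R) R) (X : set (R * R)) :
  measurable_fun setT U -> measurable_fun setT V -> indep_pair U V ->
  (forall A, measurable A -> P (U @^-1` A) = normal_prob 0 1 A) ->
  (forall A, measurable A -> P (V @^-1` A) = nu A) ->
  measurable X -> P [set t | X (U t, V t)] = P [set t | X (- U t, V t)].
Proof.
move=> mU mV UV lU lV mX.
have mN (A : set R) : measurable A -> measurable (-%R @^-1` A : set R).
  by move=> mA; have := @oppr_measurable R setT measurableT _ mA; rewrite setTI.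
have mNU : measurable_fun setT (fun t => - U t).
  exact: (measurableT_comp (@oppr_measurable R setT) mU).
rewrite (@law_pair U V (normal_prob 0 1) nu)//.
rewrite (@law_pair (fun t => - U t) V (normal_prob 0 1) nu)//.
  by move=> A B mA mB; exact: (UV _ _ (mN _ mA) mB).
move=> A mA; rewrite -[RHS](normal_prob0_opp (oner_neq0 R) mA).
exact: (lU _ (mN _ mA)).
Qed.

End pairs.

(** * Chernoff bound for independent three-valued votes *)

Section chernoff.
Context {R : realType}.

Definition vote_val (k : option bool) : R :=
  match k with Some true => 1 | Some false => -1 | None => 0 end.

(** The delicate case is [Some false], where expR l is bounded by (1 - l/2)^-2. The factor 2 in the
    quadratic term makes the remaining polynomial inequality hold up to [l = 1], where it becomes an
    equality. *)
Lemma expR_vote_val_le (l : R) (k : option bool) : 0 <= l -> l <= 1 ->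
  expR (- l * vote_val k) <= 1 - l * vote_val k + 2 * l ^+ 2 * vote_val k ^+ 2.
Proof.
move=> l0 l1; case: k => [[]|] /=; last by rewrite !(mulr0, expr0n)/= exp.expR0; lra.
  rewrite !mulr1 expRN -div1r ler_pdivrMr ?expR_gt0//.
  have h : 1 + l <= expR l by exact: expR_ge1Dx.
  have h2 : 0 <= 1 - l + 2 * l ^+ 2 by nra.
  by have := ler_wpM2l h2 h; nra.
rewrite !mulrN1 !opprK.
have h : 1 - l / 2 <= expR (- (l / 2)) by exact: expR_ge1Dx.
have e0 : 0 < expR (l / 2) by exact: expR_gt0.
have el : expR (l / 2) * (1 - l / 2) <= 1.
  rewrite -[leRHS](exp.expR0 R) -(subrr (l / 2)) exp.expRD.
  by rewrite ler_pM2l.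
have -> : expR l = expR (l / 2) ^+ 2.
  by rewrite expr2 -exp.expRD; congr expR; field.
set e := expR (l / 2) in e0 el *.
have e2 : e ^+ 2 * (1 - l / 2) ^+ 2 <= 1.
  rewrite -exprMn expr_le1// mulr_ge0//; lra.
have q0 : 0 < (1 - l / 2) ^+ 2 by apply: exprn_gt0; lra.
rewrite -(ler_pM2r q0) (le_trans e2)// -subr_ge0.
rewrite (_ : _ - _ = l ^+ 2 / 4 * ((1 - l) * (5 - 2 * l))); last by field.
by rewrite !mulr_ge0 ?divr_ge0 ?sqr_ge0//; lra.
Qed.

Context {d : measure_display} {T : measurableType d} (P : probability T R).

Lemma measure_level_sets (K : finType) (f : T -> K) (Q : pred K) :
  (forall k, measurable [set t | f t = k]) ->
  (P [set t | Q (f t)] = \sum_(k | Q k) P [set t | f t = k])%E.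
Proof.
move=> mf; rewrite (bigfs _ (index_enum_uniq K)); last first.
  by move=> k _; rewrite mem_index_enum.
rewrite -measure_fin_bigcup//.
  by congr (P _); apply/seteqP; split => t /=; [exists (f t)|case=> k Qk ->].
by move=> a b _ _ [t [/= <- <-]].
Qed.

(** Votes take three values, so all expectations are finite sums over vote patterns [a] and no
    integral appears. The second moment of each vote is at most 1, whence the term
    [2 * l ^+ 2 * n%:R]. *)
Lemma vote_tail (n : nat) (D : 'I_n -> T -> option bool) (l : R) :
  (forall i k, measurable [set t | D i t = k]) ->
  (forall a : 'I_n -> option bool,
    fine (P [set t | forall i, D i t = a i]) =
    \prod_i fine (P [set t | D i t = a i])) ->
  0 <= l -> l <= 1 ->
  fine (P [set t | \sum_i vote_val (D i t) <= 0]) <=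
  expR (- l * \sum_i (fine (P [set t | D i t = Some true]) -
                      fine (P [set t | D i t = Some false])) + 2 * l ^+ 2 * n%:R).
Proof.
move=> mD indD l0 l1.
pose p i k := fine (P [set t | D i t = k]).
have p0 i k : 0 <= p i k by exact: fine_ge0.
have finP (A : set T) : measurable A -> (fine (P A))%:E = P A.
  by move=> mA; rewrite fineK// fin_num_measure.
pose E (a : {ffun 'I_n -> option bool}) := [set t | forall i, D i t = a i].
have mE a : measurable (E a).
  exact: (@measurable_forall _ _ _ (fun i => [set t | D i t = a i])).
have sumP (Q : pred {ffun 'I_n -> option bool}) :
    (P [set t | Q [ffun i => D i t]] = \sum_(a | Q a) (fine (P (E a)))%:E)%E.
  have fE a : [set t | [ffun i => D i t] = a] = E a.
    apply/seteqP; split => t /=; first by move=> <- i; rewrite ffunE.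
    by move=> Ea; apply/ffunP => i; rewrite ffunE.
  rewrite measure_level_sets; last by move=> a; rewrite fE.
  by apply: eq_bigr => a _; rewrite fE finP.
have bo (f : option bool -> R) :
    \sum_k f k = f None + f (Some true) + f (Some false).
  rewrite (bigD1 None)//= (bigD1 (Some true))//= (bigD1 (Some false))//=.
  by rewrite big1 ?addr0 ?addrA// => -[[]|].
have p1 i : \sum_k p i k = 1.
  have := measure_level_sets predT (mD i).
  rewrite (_ : [set t | _] = setT) ?probability_setT; last by apply/seteqP; split.
  under eq_bigr do rewrite -finP//.
  by rewrite sumEFin => -[].
have := sumP [pred a : {ffun 'I_n -> option bool} | \sum_i vote_val (a i) <= 0].
rewrite (_ : [set t | _] = [set t | \sum_i vote_val (D i t) <= 0]); last first.
  have DE t : \sum_i vote_val ([ffun i => D i t] i) = \sum_i vote_val (D i t).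
    by apply: eq_bigr => i _; rewrite ffunE.
  by apply/seteqP; split => t /=; rewrite DE.
move=> ->; rewrite sumEFin/=.
(* Markov's inequality: a pattern with nonpositive sum has exponential weight at least 1, and the
   other patterns only add nonnegative terms. *)
apply: (@le_trans _ _ (\sum_(a : {ffun 'I_n -> option bool})
   \prod_i (p i (a i) * expR (- l * vote_val (a i))))).
  rewrite [leRHS](bigID (fun a : {ffun 'I_n -> option bool} => \sum_i vote_val (a i) <= 0))/=.
  apply: ler_wpDr.
    by apply: sumr_ge0 => a _; apply: prodr_ge0 => i _; rewrite mulr_ge0 ?expR_ge0.
  apply: ler_sum => a sa; rewrite indD big_split/= ler_peMr//.
    by apply: prodr_ge0 => i _; exact: p0.
  rewrite -expR_sum -big_distrr/= -(exp.expR0 R) ler_expR mulNr -mulrN.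
  by rewrite mulr_ge0// oppr_ge0.
(* The sum over patterns of products factors into the product over [i] of the moment generating
   functions. *)
rewrite -(bigA_distr_bigA (fun i k => p i k * expR (- l * vote_val k)))/=.
have -> : n%:R = \sum_(i < n) 1 :> R by rewrite sumr_const card_ord.
rewrite !mulr_sumr -big_split/= expR_sum.
apply: ler_prod => i _; rewrite sumr_ge0/=; last by move=> k _; rewrite mulr_ge0 ?expR_ge0.
apply: (@le_trans _ _ (\sum_k p i k * (1 - l * vote_val k + 2 * l ^+ 2 * vote_val k ^+ 2))).
  by apply: ler_sum => k _; rewrite ler_wpM2l// expR_vote_val_le.
apply: le_trans (expR_ge1Dx _).
have := p1 i.
rewrite !bo /= -/(p i _) -/(p i _) => pp.
have := p0 i None; have := p0 i (Some true); have := p0 i (Some false).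
nra.
Qed.
End chernoff.

(** * Bias of a single vote, and the Gaussian law of the residuals *)

Lemma measurable_bool_set {d : measure_display} {X : measurableType d}
  (b : X -> bool) : measurable_fun setT b -> measurable [set x | b x].
Proof.
by move=> mb; have := mb measurableT [set true] I; rewrite setTI.
Qed.

Section votes.
Context {R : realType}.

(* For eps = 1 (resp. -1) the test is v / u <= s (resp. - s <= v / u) with the
   denominator cleared; [None] stands for an index discarded by the algorithm. *)
Definition vote (s eps u v : R) : option bool :=
  if 1 / 2 <= `|u| then Some (eps * (v * u) <= s * u ^+ 2) else None.

Lemma measurable_vote {d : measure_display} {X : measurableType d} (s eps : R)
  (U V : X -> R) (k : option bool) :
  measurable_fun setT U -> measurable_fun setT V ->
  measurable [set t | vote s eps (U t) (V t) = k].
Proof.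
move=> mU mV; rewrite /vote.
pose b1 t := 1 / 2 <= `|U t|.
pose b2 t := eps * (V t * U t) <= s * U t ^+ 2.
have mb1 : measurable_fun setT b1.
  by apply: measurable_fun_ler => //; exact: measurableT_comp.
have mb2 : measurable_fun setT b2.
  apply: measurable_fun_ler; apply: measurable_funM => //.
    exact: measurable_funM.
  exact: measurable_funX.
case: k => [k|].
  rewrite (_ : [set t | _] = [set t | b1 t && (b2 t == k)]).
    apply: measurable_bool_set; apply: measurable_and => //.
    case: k.
      by under eq_fun do rewrite eqb_id.
    by under eq_fun do rewrite eqbF_neg; exact: measurable_neg.
  apply/seteqP; split => t /=; rewrite -/(b1 t) -/(b2 t); case: (b1 t) => //=.
    by case=> ->.
  by move=> /eqP ->.
rewrite (_ : [set t | _] = [set t | ~~ b1 t]).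
  by apply: measurable_bool_set; exact: measurable_neg.
by apply/seteqP; split => t /=; rewrite -/(b1 t); case: (b1 t).
Qed.

Context {d : measure_display} {T : measurableType d} (P : probability T R).

(** This is where the cutoff 1/2 of the algorithm enters: division by [u] at most doubles [v], so a
    residual of size s/2 keeps the ratio within s. *)
Lemma ratio_le (s u v : R) :
  0 <= s -> 1 / 2 <= `|u| -> `|v| <= s / 2 -> `|v| * `|u| <= s * u ^+ 2.
Proof.
move=> s0 hu hv; rewrite -(real_normK (num_real u)).
apply: le_trans (ler_wpM2r (normr_ge0 u) hv) _.
rewrite expr2 mulrA ler_wpM2r// ler_wpM2l//; lra.
Qed.

Lemma ratio_leE (a u v : R) : 1 / 2 <= `|u| -> (v / u <= a) = (v * u <= a * u ^+ 2).
Proof.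
move=> hu; have u0 : u != 0 by rewrite -normr_gt0 (lt_le_trans _ hu)//; lra.
have u2 : 0 < u ^+ 2 by rewrite exprn_even_gt0.
by rewrite -(ler_pM2r u2) (_ : v / u * u ^+ 2 = v * u)//; field.
Qed.

(* U and V being independent and U symmetric, a "no" vote has the same
   probability as a ratio V / U strictly below - s (for eps = 1); those
   outcomes are "yes" votes, and so are those with |V / U| <= s. *)
Lemma vote_bias (U V : T -> R) (nu : probability (measurableTypeR R) R) s eps :
  measurable_fun setT U -> measurable_fun setT V -> indep_pair P U V ->
  (forall A, measurable A -> P (U @^-1` A) = normal_prob 0 1 A) ->
  (forall A, measurable A -> P (V @^-1` A) = nu A) ->
  0 <= s -> eps ^+ 2 = 1 ->
  fine (P [set t | 1 / 2 <= `|U t|]) * fine (P [set t | `|V t| <= s / 2]) <=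
  fine (P [set t | vote s eps (U t) (V t) = Some true]) -
  fine (P [set t | vote s eps (U t) (V t) = Some false]).
Proof.
move=> mU mV UV lU lV s0 eps2.
pose Q := [set z : R * R | vote s eps z.1 z.2 = Some false].
have mQ : measurable Q.
  by apply: measurable_vote; [exact: measurable_fst|exact: measurable_snd].
have -> : P [set t | vote s eps (U t) (V t) = Some false] =
    P [set t | vote s eps (- U t) (V t) = Some false].
  exact: (law_pair_opp mU mV UV lU lV mQ).
have mNU : measurable_fun setT (fun t => - U t).
  exact: (measurableT_comp (@oppr_measurable R setT) mU).
set B := [set t | vote s eps (- U t) (V t) = _].
have mB : measurable B by exact: measurable_vote.
set G := [set t | vote s eps (U t) (V t) = _].
have mG : measurable G by exact: measurable_vote.
pose A1 := [set x : R | 1 / 2 <= `|x|].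
pose A2 := [set x : R | `|x| <= s / 2].
have mA1 : measurable A1.
  by apply: measurable_bool_set; apply: measurable_fun_ler => //; exact: measurableT_comp.
have mA2 : measurable A2.
  by apply: measurable_bool_set; apply: measurable_fun_ler => //; exact: measurableT_comp.
have mUA : measurable (U @^-1` A1) by have := mU measurableT _ mA1; rewrite setTI.
have mVA : measurable (V @^-1` A2) by have := mV measurableT _ mA2; rewrite setTI.
have H := UV _ _ mA1 mA2.
rewrite lerBrDr.
rewrite -[X in X <= _]/(fine (P (U @^-1` A1)) * fine (P (V @^-1` A2)) + fine (P B)).
rewrite -fineM ?fin_num_measure// -H.
have mI : measurable (U @^-1` A1 `&` V @^-1` A2) by exact: measurableI.
rewrite -fineD ?fin_num_measure//.
rewrite -measureU//.
  apply: fine_le; rewrite ?fin_num_measure//; first exact: measurableU.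
  apply: le_measure; rewrite ?inE//; first exact: measurableU.
  move=> t; rewrite /B /G /A1 /A2 /vote /= => -[[h1 h2]|].
    rewrite h1; congr Some.
    have e1 : `|eps| = 1.
      by apply/eqP; rewrite -sqrp_eq1// real_normK ?num_real// eps2.
    apply: le_trans (ler_norm _) _.
    by rewrite !normrM e1 mul1r; exact: ratio_le.
  rewrite normrN; case: ifP => // _ [] /negbT; rewrite -ltNge sqrrN !mulrN => h.
  congr Some; have : 0 <= s * U t ^+ 2 by rewrite mulr_ge0// sqr_ge0.
  by lra.
apply/seteqP; split => t //=; rewrite /B /A1 /A2 /vote /= normrN => -[[h1 h2]].
rewrite h1 => -[] /negbT; rewrite -ltNge sqrrN !mulrN => h.
have e1 : `|eps| = 1.
  by apply/eqP; rewrite -sqrp_eq1// real_normK ?num_real// eps2.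
have : - (eps * (V t * U t)) <= `|V t| * `|U t|.
  apply: le_trans (ler_norm _) _.
  by rewrite normrN !normrM e1 mul1r.
rewrite leNgt => /negP; apply.
apply: le_lt_trans h.
exact: ratio_le.
Qed.

(** The sign is specified only through its masses at 1 and -1; this turns that into an almost sure
    statement. *)
Lemma rademacher_null (S : T -> R) : measurable_fun setT S ->
  P (S @^-1` [set 1]) = (1 / 2)%:E -> P (S @^-1` [set -1]) = (1 / 2)%:E ->
  P (~` (S @^-1` [set 1] `|` S @^-1` [set -1])) = 0%E.
Proof.
move=> mS S1 SN1.
have mpre (B : set R) : measurable B -> measurable (S @^-1` B).
  by move=> mB; have := mS measurableT _ mB; rewrite setTI.
have m1 : measurable (S @^-1` [set 1]) by exact: mpre.
have mN1 : measurable (S @^-1` [set -1]) by exact: mpre.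
have P1 : P (S @^-1` [set 1] `|` S @^-1` [set -1]) = 1%E.
  transitivity (P (S @^-1` [set 1%R]) + P (S @^-1` [set (-1)%R]))%E.
    apply: measureU => //; apply/seteqP; split => t //= [-> /eqP].
    by rewrite -subr_eq0 opprK -(natrD _ 1 1) pnatr_eq0.
  by rewrite S1 SN1 -EFinD (_ : _ + _ = 1)//; lra.
by rewrite probability_setC ?P1 ?subee//; exact: measurableU.
Qed.

(** On [S = 1] the product is [W], on [S = -1] it is [- W], which has the same law; what remains is
    the null set [N]. *)
Lemma law_sign_mul (S W : T -> R) s :
  s != 0 -> measurable_fun setT S -> measurable_fun setT W -> indep_pair P S W ->
  P (S @^-1` [set 1]) = (1 / 2)%:E -> P (S @^-1` [set -1]) = (1 / 2)%:E ->
  (forall A, measurable A -> P (W @^-1` A) = normal_prob 0 s A) ->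
  forall A, measurable A ->
    P ((fun t => S t * W t) @^-1` A) = normal_prob 0 s A.
Proof.
move=> s0 mS mW SW S1 SN1 lW A mA.
have mpre (f : T -> R) (B : set R) : measurable_fun setT f -> measurable B ->
    measurable (f @^-1` B).
  by move=> mf mB; have := mf measurableT _ mB; rewrite setTI.
have mNA : measurable (-%R @^-1` A : set R).
  by have := @oppr_measurable R setT measurableT _ mA; rewrite setTI.
have mSW : measurable_fun setT (fun t => S t * W t) by exact: measurable_funM.
have m1 : measurable (S @^-1` [set 1]) by exact: mpre.
have mN1 : measurable (S @^-1` [set -1]) by exact: mpre.
have mE := mpre _ _ mSW mA.
pose B1 := S @^-1` [set 1] `&` W @^-1` A.
pose B2 := S @^-1` [set -1] `&` W @^-1` (-%R @^-1` A).
have mB1 : measurable B1 by apply: measurableI => //; exact: mpre.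
have mB2 : measurable B2 by apply: measurableI => //; exact: mpre.
have dis (X Y : set T) : S @^-1` [set 1] `&` X `&` (S @^-1` [set -1] `&` Y) = set0.
  apply/seteqP; split => t //= [[-> _] [/eqP]].
  by rewrite -subr_eq0 opprK -(natrD _ 1 1) pnatr_eq0.
set E := _ @^-1` A in mE *.
have PB12 : P (B1 `|` B2) = normal_prob 0 s A.
  have m1' (x : R) : measurable [set x] by exact: measurable_set1.
  have PB1 : P B1 = ((1 / 2)%:E * normal_prob 0 s A)%E.
    by rewrite -S1 -(lW A mA); exact: SW.
  have PB2 : P B2 = ((1 / 2)%:E * normal_prob 0 s A)%E.
    by rewrite -SN1 -(normal_prob0_opp s0 mA) -(lW _ mNA); exact: SW.
  transitivity (P B1 + P B2)%E; first by apply: measureU => //; exact: dis.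
  rewrite PB1 PB2 -ge0_muleDl// -EFinD.
  by rewrite (_ : _ + _ = 1) ?mul1e//; lra.
pose N := ~` (S @^-1` [set 1] `|` S @^-1` [set -1]).
have mN : measurable N by apply: measurableC; exact: measurableU.
have PN : P N = 0%E by exact: rademacher_null.
apply/eqP; rewrite eq_le -PB12; apply/andP; split.
  rewrite -[leRHS]adde0 -PN.
  apply: (@le_trans _ _ (P (B1 `|` B2 `|` N))).
    apply: le_measure; rewrite ?inE//.
      by apply: measurableU => //; exact: measurableU.
    move=> t Et; have [S1t|S1t] := eqVneq (S t) 1.
      by left; left; split => //; rewrite /= -[W t]mul1r -S1t.
    have [SN1t|SN1t] := eqVneq (S t) (-1).
      by left; right; split => //; rewrite /= -mulN1r -SN1t.
    by right => -[] /= /eqP; apply/negP.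
  by apply: measureU2 => //; exact: measurableU.
apply: le_measure; rewrite ?inE//; first exact: measurableU.
by move=> t [[/= S1t]|[/= S1t]] At; rewrite /E /= S1t ?mul1r ?mulN1r.
Qed.

(** Gaussian terms are added one at a time. [J0] holds the coordinates behind [W], so that the
    partial sum [V] depends only on [J] and each new term, being outside [J], is independent of it.
    Starting from [W] keeps the variance positive. *)
Lemma law_linear_comb (I : finType) (F : I -> T -> R) (J0 : {set I})
    (K : eqType) (x : K -> I) (b : K -> R) (W : T -> R) (L : seq K) :
  (forall i, measurable_fun setT (F i)) -> mutually_independent P F ->
  injective x -> (forall k, x k \notin J0) ->
  (forall k A, measurable A -> P (F (x k) @^-1` A) = normal_prob 0 1 A) ->
  measurable_fun setT (W : sigma_of F J0 -> R) ->
  (forall A, measurable A -> P (W @^-1` A) = normal_prob 0 1 A) ->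
  uniq L ->
  forall A, measurable A ->
    P ((fun t => \sum_(k <- L) b k * F (x k) t + W t) @^-1` A) =
    normal_prob 0 (Num.sqrt (1 + \sum_(k <- L) b k ^+ 2)) A.
Proof.
move=> mF indF injx xJ0 lF mW lW.
elim: L => [_ A mA|k L IH /= /andP[kL uL] A mA].
  rewrite big_nil addr0 sqrtr1 -lW//; congr (P _).
  by apply/seteqP; split => t /=; rewrite big_nil add0r.
pose J := J0 :|: [set i in map x L].
pose V t := \sum_(l <- L) b l * F (x l) t + W t.
have mVJ : measurable_fun setT (V : sigma_of F J -> R).
  apply: measurable_funD; last first.
    move=> _ B mB; have := mW measurableT _ mB; apply: sub_smallest2r.
      exact: smallest_sigma_algebra.
    by apply: cylindersS; exact: finset.subsetUl.
  under eq_fun do rewrite big_seq big_mkcond/=.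
  apply: measurable_sum => l; case: (boolP (l \in L)) => // lL.
  apply: measurable_funM => //; apply: measurable_coord => //.
  by rewrite !inE map_f ?orbT.
have mV : measurable_fun setT V.
  by move=> _ B mB; rewrite setTI; have := mVJ measurableT _ mB; rewrite setTI;
    exact: sigma_of_measurable.
have ind : indep_pair P (F (x k)) V.
  apply: (@independent_pair _ _ _ _ _ F [set x k]%SET J) => //; last first.
    by apply: measurable_coord => //; rewrite inE.
  rewrite disjoints1 !inE negb_or xJ0/=.
  by rewrite mem_map.
have s0 : 0 < Num.sqrt (1 + \sum_(l <- L) b l ^+ 2).
  by rewrite sqrtr_gt0 ltr_pwDl// sumr_ge0// => l _; exact: sqr_ge0.
rewrite big_cons.
have -> : (fun t => \sum_(l <- k :: L) b l * F (x l) t + W t) @^-1` A =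
    (fun t => b k * F (x k) t + V t) @^-1` A.
  by apply/seteqP; split => t /=; rewrite big_cons /V addrA.
rewrite (law_add_normal (b k) s0 (mF _) mV ind (lF k) (IH uL) mA).
rewrite sqr_sqrtr; last by apply: addr_ge0 => //; apply: sumr_ge0 => l _; exact: sqr_ge0.
by rewrite -addrA [X in 1 + X]addrC.
Qed.

End votes.

(** * The median as the outcome of a majority vote *)

Section median.
Context {R : realType}.
Implicit Types (s : seq R) (p : pred R).

(** On a sorted list, a downward closed predicate holds exactly on a prefix. *)
Lemma sorted_nth_count s p k : sorted <=%R s ->
  (forall x y, x <= y -> p y -> p x) -> (k < size s)%N ->
  p (nth 0 s k) = (k < count p s)%N.
Proof.
move=> + down; elim: s k => //= x s IH k xs ks.
have xmin : all (>= x) s by exact: order_path_min le_trans xs.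
have np : ~~ p x -> count p s = 0%N.
  move=> npx; apply/eqP; rewrite -leqn0 leqNgt -has_count; apply/hasPn => y ys.
  by apply: contra npx; apply: down; exact: (allP xmin).
case: k ks => [_|k ks] /=; first by case: (boolP (p x)) => // /np ->.
rewrite (IH _ (path_sorted xs) ks).
by case: (boolP (p x)) => [px|/np ->]; rewrite ?add1n ?ltnS.
Qed.

Lemma median_count s p : (forall x y, x <= y -> p y -> p x) -> s != [::] ->
  p (median s) = ((size s).-1./2 < count p s)%N.
Proof.
move=> down s0; have -> : median s = nth 0 (sort <=%R s) (size s).-1./2.
  by case: s s0.
rewrite sorted_nth_count//.
- by rewrite (permP (permEl (perm_sort _ _))).
- by apply: sort_sorted; exact: le_total.
- rewrite size_sort; case: s s0 => //= x s _.
  by rewrite ltnS -divn2 leq_div.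
Qed.

Lemma sum_sign_count s p :
  \sum_(x <- s) @vote_val R (Some (p x)) = (count p s).*2%:R - (size s)%:R.
Proof.
elim: s => [|x s IH]; first by rewrite big_nil subrr.
rewrite big_cons IH /= doubleD natrD -addn1 natrD.
by case: (p x) => /=; [rewrite -[1.*2%N]/2%N|rewrite double0]; ring.
Qed.

Variables (n : nat) (m : pred 'I_n) (r : 'I_n -> R).
Let rs := [seq r i | i <- enum 'I_n & m i].

Lemma sum_vote_filter p :
  \sum_i @vote_val R (if m i then Some (p (r i)) else None) =
  \sum_(x <- rs) @vote_val R (Some (p x)).
Proof.
rewrite big_map big_filter big_enum_cond/= [RHS]big_mkcond/=.
by apply: eq_bigr => i _; case: (m i).
Qed.

Lemma median_gt_votes a : a < median rs ->
  \sum_i @vote_val R (if m i then Some (r i <= a) else None) <= 0.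
Proof.
move=> amed; rewrite (sum_vote_filter (fun x => x <= a)) sum_sign_count.
(* With every index discarded the median is the default value 0, but the vote sum is then 0 too. *)
have [->|rs0] := eqVneq rs [::]; first by rewrite subrr.
have := @median_count rs (fun x => x <= a) (fun x y xy => le_trans xy) rs0.
rewrite leNgt amed /= => /esym/negbT; rewrite -leqNgt => h.
rewrite subr_le0 ler_nat; apply: leq_trans (leq_pred _).
by rewrite -(odd_double_half (size rs).-1) (leq_trans _ (leq_addl _ _))// leq_double.
Qed.

(** If c of the N kept ratios lie below [b], the rank of the lower median only gives N - 1 < 2c.
    This suffices: N - c <= c, and a tie still makes the sum nonpositive. *)
Lemma median_lt_votes b : median rs < b ->
  \sum_i @vote_val R (if m i then Some (b <= r i) else None) <= 0.
Proof.
move=> bmed; rewrite (sum_vote_filter (fun x => b <= x)) sum_sign_count.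
have [->|rs0] := eqVneq rs [::]; first by rewrite subrr.
have := @median_count rs (fun x => x < b) (fun x y xy => le_lt_trans xy) rs0.
rewrite bmed => /esym h.
have e : (count (fun x => (b <= x)%R) rs + count (fun x => (x < b)%R) rs = size rs)%N.
  rewrite -(count_predC (fun x => b <= x)); congr addn; apply: eq_count => x.
  by rewrite /= ltNge.
rewrite subr_le0 ler_nat -e -addnn leq_add2l.
move/idP: h; rewrite -e ltn_half_double; move: (count _ _) (count _ _).
by move=> c c'; lia.
Qed.

End median.

(** * Measurability of the median *)

Lemma measurable_finite_pred {d : measure_display} {T : measurableType d}
    (K : finType) (f : T -> K) (Q : pred K) :
  (forall k, measurable [set t | f t = k]) -> measurable [set t | Q (f t)].
Proof.
move=> mf; rewrite (_ : [set t | _] = \bigcup_(k in [set k | Q k]) [set t | f t = k]).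
  by apply: fin_bigcup_measurable => //; exact: finite_finset.
by apply/seteqP; split => t /=; [exists (f t)|case=> k Qk ->].
Qed.

(** Whether the median is at most [a] is decided by finitely many booleans: which indices are kept,
    and which kept ratios are at most [a]. *)
Lemma measurable_median {R : realType} {d : measure_display}
    {T : measurableType d} (n : nat) (m : 'I_n -> T -> bool) (r : 'I_n -> T -> R) :
  (forall i, measurable [set t | m i t]) ->
  (forall i a, measurable [set t | m i t && (r i t <= a)]) ->
  measurable_fun setT (fun t => median [seq r i t | i <- enum 'I_n & m i t]).
Proof.
move=> mm mr; apply: (measurability _ (RGenOInfty.measurableE R)) => //.
move=> _ [_ [a ->] <-]; rewrite setTI.
pose f t := [ffun i : 'I_n => (m i t, m i t && (r i t <= a))].
(* The case [N == 0] accounts for the value 0 of the median on the empty list. *)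
pose Q (k : {ffun 'I_n -> bool * bool}) :=
  let N := count (fun i => (k i).1) (enum 'I_n) in
  if N == 0%N then 0 <= a
  else (N.-1./2 < count (fun i => (k i).2) (enum 'I_n))%N.
have -> : (fun t => median [seq r i t | i <- enum 'I_n & m i t]) @^-1` `]a, +oo[ =
    [set t | ~~ Q (f t)].
  suff H t : Q (f t) = (median [seq r i t | i <- enum 'I_n & m i t] <= a).
    by apply/seteqP; split => t /=; rewrite H -ltNge in_itv/= andbT.
  set s := [seq _ | _ <- _ & _].
  rewrite /Q; have -> : count (fun i => (f t i).1) (enum 'I_n) = size s.
    by rewrite size_map size_filter; apply: eq_count => i; rewrite ffunE.
  have [/size0nil ->//|s0] := eqVneq (size s) 0%N.
  rewrite (@median_count _ s (fun x => x <= a)); last 2 first.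
  - by move=> x y; exact: le_trans.
  - by apply: contraNneq s0 => ->.
  congr (_ < _)%N; rewrite /s count_map count_filter; apply: eq_count => i.
  by rewrite ffunE /= andbC.
apply: (@measurable_finite_pred _ _ _ f (fun k => ~~ Q k)) => k.
rewrite (_ : [set t | _] = [set t | forall i,
    [set t | m i t = (k i).1 /\ m i t && (r i t <= a) = (k i).2] t]).
  have mB (g : T -> bool) c : measurable [set t | g t] -> measurable [set t | g t = c].
    case: c => // mg; rewrite (_ : [set t | _] = ~` [set t | g t]).
      exact: measurableC.
    by apply/seteqP; split => t /=; case: (g t).
  apply: measurable_forall => i.
  exact: (measurableI _ _ (mB _ _ (mm i)) (mB _ _ (mr i a))).
apply/seteqP; split => t /=.
  by move=> <- i; rewrite /f ffunE.
move=> h; apply/ffunP => i; have [h1 h2] := h i.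
by rewrite ffunE h2 h1; case: (k i).
Qed.

(** * Analysis of the algorithm *)

Section coordinatewise_median.
Context {R : realType} {dT : measure_display} {T : measurableType dT}.
Variables (P : probability T R) (n d : nat).
Variables (X : 'I_n -> 'I_d -> {RV P >-> R}) (w sg : 'I_n -> {RV P >-> R}).
Variables (beta : 'I_d -> R) (eta : 'I_n -> R).

Definition coords (k : ('I_n * 'I_d) + ('I_n + 'I_n)) : T -> R :=
  match k with
  | inl ij => X ij.1 ij.2
  | inr (inl i) => w i
  | inr (inr i) => sg i
  end.

(** The randomness behind the votes of row [i]; these sets are disjoint, which makes the votes of
    different rows independent. *)
Definition row_coords i : {set ('I_n * 'I_d) + ('I_n + 'I_n)} :=
  [set k | match k with
           | inl ij => ij.1 == i
           | inr (inl l) => l == i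
           | inr (inr l) => l == i
           end]%SET.

(** V_i of the overview with sg_i^2 = 1 already substituted. In this form [X i j] does not occur at
    all, so independence from it holds exactly, also where the sign is not 1 or -1. *)
Definition residual i j t :=
  \sum_(l < d | l != j) beta l * X i l t + sg i t * w i t + eta i.

(** A common upper bound for the standard deviations [dev j], so that one threshold serves all
    coordinates. *)
Definition beta_scale := Num.sqrt (1 + \sum_(l < d) beta l ^+ 2).

Lemma measurable_coords k : measurable_fun setT (coords k).
Proof. by case: k => [[i j]|[i|i]]; exact: measurable_funP. Qed.

Lemma measurable_residual (J : {set ('I_n * 'I_d) + ('I_n + 'I_n)}) i j :
  (forall l, l != j -> inl (i, l) \in J) ->
  inr (inl i) \in J -> inr (inr i) \in J ->
  measurable_fun setT (residual i j : sigma_of coords J -> R).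
Proof.
move=> JX Jw Jsg; apply: measurable_funD => //; apply: measurable_funD; last first.
  apply: measurable_funM.
    exact: (@measurable_coord _ _ _ _ coords _ _ Jsg).
  exact: (@measurable_coord _ _ _ _ coords _ _ Jw).
under eq_fun do rewrite big_mkcond/=.
apply: measurable_sum => l; case: (boolP (l != j)) => // lj.
apply: measurable_funM => //.
exact: (@measurable_coord _ _ _ _ coords _ _ (JX l lj)).
Qed.

Hypothesis lX : forall i j A, measurable A -> P (X i j @^-1` A) = normal_prob 0 1 A.
Hypothesis lw : forall i A, measurable A -> P (w i @^-1` A) = normal_prob 0 1 A.
Hypothesis lsg : forall i, P (sg i @^-1` [set 1]) = (1 / 2)%:E /\
                           P (sg i @^-1` [set -1]) = (1 / 2)%:E.
Hypothesis indF : mutually_independent P coords.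

Lemma indep_residual i j : indep_pair P (X i j) (residual i j).
Proof.
apply (@independent_pair _ _ _ P _ coords [set inl (i, j)]%SET
  (row_coords i :\ inl (i, j))%SET (X i j) (residual i j) (@measurable_coords) indF).
- by rewrite disjoints1 !inE eqxx.
- exact: (@measurable_coord _ _ _ _ coords _ (inl (i, j)) (finset.set11 _)).
- apply: measurable_residual => [l lj||]; rewrite !inE ?eqxx// andbT.
  by apply: contraNneq lj => -[->].
Qed.

Lemma measurable_residualT i j : measurable_fun setT (residual i j).
Proof.
have mr : measurable_fun setT (residual i j : sigma_of coords [set: _]%SET -> R).
  by apply: measurable_residual => *; rewrite inE.
move=> _ B mB; rewrite setTI; have := mr measurableT _ mB; rewrite setTI.
by apply: sigma_of_measurable; exact: @measurable_coords.
Qed.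

Let dev j := Num.sqrt (1 + \sum_(l < d | l != j) beta l ^+ 2).

Lemma dev_ge1 j : 1 <= dev j.
Proof.
rewrite -[leLHS]sqrtr1 ler_sqrt; last by rewrite addr_ge0// sumr_ge0// => l _; exact: sqr_ge0.
by rewrite lerDl sumr_ge0// => l _; exact: sqr_ge0.
Qed.

Lemma dev_le j : dev j <= beta_scale.
Proof.
rewrite ler_sqrt; last by rewrite addr_ge0// sumr_ge0// => l _; exact: sqr_ge0.
by rewrite lerD2l [leRHS](bigD1 j)//= lerDr sqr_ge0.
Qed.

Lemma law_residual i j A : measurable A ->
  P (residual i j @^-1` A) = normal_prob (eta i) (dev j) A.
Proof.
move=> mA.
pose W t := sg i t * w i t.
have lW B : measurable B -> P (W @^-1` B) = normal_prob 0 1 B.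
  have ind : indep_pair P (sg i) (w i).
    apply (@independent_pair _ _ _ P _ coords [set inr (inr i)]%SET
      [set inr (inl i)]%SET (sg i) (w i) (@measurable_coords) indF).
    - by rewrite disjoints1 inE.
    - exact: (@measurable_coord _ _ _ _ coords _ (inr (inr i)) (finset.set11 _)).
    - exact: (@measurable_coord _ _ _ _ coords _ (inr (inl i)) (finset.set11 _)).
  have [sg1 sgN1] := @lsg i.
  exact: (@law_sign_mul _ _ _ P (sg i) (w i) 1 (oner_neq0 R)
    (@measurable_coords (inr (inr i))) (@measurable_coords (inr (inl i))) ind
    sg1 sgN1 (@lw i)).
pose L := [seq l <- index_enum 'I_d | l != j].
have uL : uniq L by rewrite filter_uniq// index_enum_uniq.
pose J0 : {set ('I_n * 'I_d) + ('I_n + 'I_n)} := [set inr (inl i); inr (inr i)]%SET.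
have mW : measurable_fun setT (W : sigma_of coords J0 -> R).
  apply: measurable_funM.
    by apply: (@measurable_coord _ _ _ _ coords J0 (inr (inr i))); rewrite !inE eqxx orbT.
  by apply: (@measurable_coord _ _ _ _ coords J0 (inr (inl i))); rewrite !inE eqxx.
have mc : measurable ((fun x => x + eta i) @^-1` A).
  have mf : measurable_fun setT (fun x : R => x + eta i) by exact: measurable_funD.
  by have := mf measurableT _ mA; rewrite setTI.
have injx : injective (fun l : 'I_d => inl (i, l) : ('I_n * 'I_d) + ('I_n + 'I_n)).
  by move=> l l' [].
have xJ0 (l : 'I_d) : inl (i, l) \notin J0 by rewrite !inE.
have := @law_linear_comb _ _ _ P _ coords J0 _ (fun l => inl (i, l)) beta W L
  (@measurable_coords) indF injx xJ0 (fun l => @lX i l) mW lW uL _ mc.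
rewrite big_filter -/(dev j) normal_prob_shift//; last first.
  by rewrite gt_eqF// (lt_le_trans _ (dev_ge1 j)).
rewrite add0r => <-; congr (P _).
by apply/seteqP; split => t /=; rewrite /residual big_filter.
Qed.

Lemma residual_ball i j t : `|eta i| <= 1 -> 0 <= t -> t <= 1 ->
  normal_lower_const * t <=
  fine (P [set x | `|residual i j x| <= t * beta_scale / 2]).
Proof.
move=> e1 t0 t1.
have m_ball (r : R) : measurable [set x : R | `|x| <= r].
  by apply: measurable_bool_set; apply: measurable_fun_ler => //; exact: measurableT_comp.
rewrite -lee_fin fineK; last first.
  apply: fin_num_measure; apply: measurable_bool_set; apply: measurable_fun_ler => //.
  by apply: measurableT_comp => //; exact: measurable_residualT.
have v0 : dev j != 0 by rewrite gt_eqF// (lt_le_trans _ (dev_ge1 j)).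
have -> : P [set x | `|residual i j x| <= t * beta_scale / 2] =
    normal_prob 0 (dev j) ((fun x => x + eta i) @^-1` [set x | `|x| <= t * beta_scale / 2]).
  rewrite normal_prob_shift// add0r -(law_residual i)//.
apply: le_trans (normal_prob_ball_ge (dev_ge1 j) e1 t0 t1) _.
have ms r : measurable [set x : R | `|x + eta i| <= r].
  apply: measurable_bool_set; apply: measurable_fun_ler => //.
  by apply: measurableT_comp => //; exact: measurable_funD.
apply: le_measure; rewrite ?inE; try exact: ms.
move=> x /= h; apply: le_trans h _.
by rewrite ler_wpM2r// ler_wpM2l// dev_le.
Qed.


Local Notation kappa := (@normal_lower_const R).
Local Notation votes s eps i j t := (vote s eps (X i j t) (residual i j t)).

(** The interval [1/2, 3/2] is the ball of [normal_prob_ball_ge] with [c = -1] and [v = t = 1], so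
    the same constant bounds both factors of the bias. *)
Lemma normal_lower_const_le i j :
  kappa <= fine (P [set t | 1 / 2 <= `|X i j t|]).
Proof.
have mA (c r : R) : measurable [set x : R | `|x + c| <= r].
  apply: measurable_bool_set; apply: measurable_fun_ler => //.
  by apply: measurableT_comp => //; exact: measurable_funD.
have mB : measurable [set x : R | 1 / 2 <= `|x|].
  by apply: measurable_bool_set; apply: measurable_fun_ler => //; exact: measurableT_comp.
rewrite -lee_fin fineK; last first.
  apply: fin_num_measure; apply: measurable_bool_set; apply: measurable_fun_ler => //.
  by apply: measurableT_comp.
have -> : P [set t | 1 / 2 <= `|X i j t|] = normal_prob 0 1 [set x : R | 1 / 2 <= `|x|].
  by rewrite -(lX i j).
have N1 : `|-1 : R| <= 1 by rewrite normrN normr1.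
have := @normal_prob_ball_ge R 1 (-1) 1 (lexx _) N1 ler01 (lexx _).
rewrite !mulr1 => h; apply: le_trans h _.
apply: le_measure; rewrite ?inE; [exact: mA|exact: mB|].
move=> x /=; rewrite ler_norml => /andP[h1 h2].
apply: le_trans (ler_norm _); lra.
Qed.

Lemma normal_lower_const_le1 : kappa <= 1.
Proof.
have N0 : `|0 : R| <= 1 by rewrite normr0.
have := @normal_prob_ball_ge R 1 0 1 (lexx _) N0 ler01 (lexx _).
rewrite !mulr1 => h; rewrite -lee_fin; apply: le_trans h _.
apply: probability_le1; apply: measurable_bool_set; apply: measurable_fun_ler => //.
by apply: measurableT_comp => //; exact: measurable_funD.
Qed.

Definition bias (s eps : R) i j : R :=
  fine (P [set t | votes s eps i j t = Some true]) -
  fine (P [set t | votes s eps i j t = Some false]).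

Lemma bias_ge s eps i j : 0 <= s -> eps ^+ 2 = 1 ->
  fine (P [set t | 1 / 2 <= `|X i j t|]) *
  fine (P [set t | `|residual i j t| <= s / 2]) <= bias s eps i j.
Proof.
move=> s0 eps2; apply: (@vote_bias _ _ _ P (X i j) (residual i j)
  (normal_prob (eta i) (dev j))) => //.
- exact: measurable_residualT.
- exact: indep_residual.
- by move=> A mA; exact: lX.
- by move=> A mA; exact: law_residual.
Qed.

Lemma bias_ge0 s eps i j : 0 <= s -> eps ^+ 2 = 1 -> 0 <= bias s eps i j.
Proof.
move=> s0 eps2; apply: le_trans (bias_ge i j s0 eps2).
by rewrite mulr_ge0// fine_ge0.
Qed.

Lemma bias_ge_good t eps i j : `|eta i| <= 1 -> 0 <= t -> t <= 1 ->
  eps ^+ 2 = 1 -> kappa ^+ 2 * t <= bias (t * beta_scale) eps i j.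
Proof.
move=> e1 t0 t1 eps2; apply: le_trans (bias_ge i j _ eps2); last first.
  by rewrite mulr_ge0 ?sqrtr_ge0.
rewrite expr2 -mulrA ler_pM ?mulr_ge0 ?(ltW normal_lower_const_gt0)//.
  exact: normal_lower_const_le.
exact: residual_ball.
Qed.

Lemma row_coords_disjoint k l : k != l -> [disjoint row_coords k & row_coords l]%B.
Proof.
move=> kl; rewrite disjoint_subset; apply/fintype.subsetP.
by case=> [[i j]|[i|i]]; rewrite !inE /= => /eqP ->.
Qed.

Lemma measurable_row_votes (s eps : R) i j k :
  <<s cylinders coords (row_coords i) >> [set t | votes s eps i j t = k].
Proof.
apply: (@measurable_vote _ _ (sigma_of coords (row_coords i)) s eps
  (X i j) (residual i j) k).
  by apply: (@measurable_coord _ _ _ _ coords _ (inl (i, j))); rewrite inE /=.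
by apply: measurable_residual => [l _||]; rewrite inE /=.
Qed.

Variables (alpha : R).
Hypothesis alpha_gt0 : 0 < alpha.
Hypothesis alpha_le1 : alpha <= 1.
Hypothesis alpha_good : alpha * n%:R <= #|[pred i : 'I_n | `|eta i| <= 1]|%:R.

Lemma vote_sum_tail t eps j : 0 <= t -> t <= 1 -> eps ^+ 2 = 1 ->
  fine (P [set x | \sum_i @vote_val R (votes (t * beta_scale) eps i j x) <= 0]) <=
  expR (- (kappa ^+ 4 / 8 * (alpha ^+ 2 * n%:R * t ^+ 2))).
Proof.
move=> t0 t1 eps2.
have k0 := @normal_lower_const_gt0 R; have k1 := normal_lower_const_le1.
have s0 : 0 <= t * beta_scale by rewrite mulr_ge0 ?sqrtr_ge0.
(* With m = alpha n kappa^2 t, the lower bound on the total bias, this is the minimizer m / (4 n) of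
   - l m + 2 l^2 n. *)
pose l := kappa ^+ 2 * alpha * t / 4.
have l0 : 0 <= l by rewrite divr_ge0// !mulr_ge0// ltW.
have l1 : l <= 1.
  have h1 : kappa ^+ 2 <= 1 by rewrite expr_le1// ltW.
  have h2 : kappa ^+ 2 * alpha <= 1 by rewrite mulr_ile1 ?sqr_ge0// ltW.
  have : kappa ^+ 2 * alpha * t <= 1 by rewrite mulr_ile1// mulr_ge0 ?sqr_ge0// ltW.
  by rewrite /l; lra.
have mD i k : measurable [set x | votes (t * beta_scale) eps i j x = k].
  by apply: measurable_vote => //; exact: measurable_residualT.
apply: le_trans (vote_tail mD _ l0 l1) _.
  move=> a; apply: (@independent_sigma _ _ _ P _ coords (@measurable_coords) indF _
    row_coords row_coords_disjoint (fun i => [set x | votes (t * beta_scale) eps i j x = a i])).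
  by move=> i; exact: measurable_row_votes.
rewrite ler_expR.
have sb : alpha * n%:R * (kappa ^+ 2 * t) <= \sum_i bias (t * beta_scale) eps i j.
  (* Rows with large noise are dropped from the sum, their bias being nonnegative. *)
  apply: (@le_trans _ _ (\sum_(i | `|eta i| <= 1) kappa ^+ 2 * t)).
    rewrite sumr_const -[leRHS]mulr_natl ler_wpM2r//.
    by apply: mulr_ge0 => //; exact: sqr_ge0.
  rewrite [leRHS](bigID (fun i => `|eta i| <= 1))/= ler_wpDr//.
    by apply: sumr_ge0 => i _; exact: bias_ge0.
  by apply: ler_sum => i ei; exact: bias_ge_good.
have := ler_wpM2l l0 sb; rewrite -/(bias _ _ _ _).
rewrite (_ : \sum_i (_ - _) = \sum_i bias (t * beta_scale) eps i j)//.
move: (\sum_i _) => S h.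
apply: (@le_trans _ _ (- (l * (alpha * n%:R * (kappa ^+ 2 * t))) + 2 * l ^+ 2 * n%:R)).
  by rewrite lerD2r mulNr lerN2.
by rewrite le_eqVlt; apply/orP; left; apply/eqP; rewrite /l; field.
Qed.

Definition estimate j t :=
  cw_median (fun i => \sum_(l < d) X i l t * beta l + eta i)
    (fun i l => X i l t) (fun i => w i t) (fun i => sg i t) j.

Lemma measurable_estimate j : measurable_fun setT (estimate j).
Proof.
pose num i t := sg i t * (\sum_(l < d) X i l t * beta l + eta i) + w i t.
pose den i t := sg i t * X i j t.
have mnum i : measurable_fun setT (num i).
  apply: measurable_funD => //; apply: measurable_funM => //.
  apply: measurable_funD => //; apply: measurable_sum => l.
  exact: measurable_funM.
have mden i : measurable_fun setT (den i) by exact: measurable_funM.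
have mm i : measurable_fun setT (fun t => 1 / 2 <= `|den i t|).
  by apply: measurable_fun_ler => //; exact: measurableT_comp.
apply: (@measurable_median _ _ _ n (fun i t => 1 / 2 <= `|den i t|)
  (fun i t => num i t / den i t)) => [i|i a].
  exact: measurable_bool_set.
have -> : [set t | (1 / 2 <= `|den i t|) && (num i t / den i t <= a)] =
    [set t | (1 / 2 <= `|den i t|) && (num i t * den i t <= a * den i t ^+ 2)].
  by apply/seteqP; split => t /= /andP[h1]; rewrite h1 /= ratio_leE.
apply: measurable_bool_set; apply: measurable_and => //.
apply: measurable_fun_ler; first exact: measurable_funM.
by apply: measurable_funM => //; exact: measurable_funX.
Qed.

(** The sign cancels between numerator and denominator, except that it moves onto the noise: w / (sg
    X) = sg w / X. *)
Lemma ratio_estimate i j t : sg i t ^+ 2 = 1 -> 1 / 2 <= `|sg i t * X i j t| ->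
  (sg i t * (\sum_(l < d) X i l t * beta l + eta i) + w i t) / (sg i t * X i j t) =
  beta j + residual i j t / X i j t.
Proof.
move=> sg2 h.
have : sg i t * X i j t != 0 by rewrite -normr_gt0 (lt_le_trans _ h)//; lra.
rewrite mulf_eq0 negb_or => /andP[sg0 X0].
rewrite /residual (bigD1 j)//=.
under eq_bigr do rewrite mulrC.
move: (\sum_(_ | _) _) => S.
apply: (canLR (mulfK _)); first by rewrite mulf_neq0.
rewrite (_ : _ * (sg i t * X i j t) = sg i t * X i j t * beta j + sg i t * (S + eta i) +
  sg i t ^+ 2 * w i t); last by field.
by rewrite sg2; ring.
Qed.

Lemma norm_sign_mul i j t : sg i t ^+ 2 = 1 -> `|X i j t| = `|sg i t * X i j t|.
Proof.
move=> sg2; rewrite normrM (_ : `|sg i t| = 1) ?mul1r//.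
by apply/eqP; rewrite -sqrp_eq1// real_normK ?num_real// sg2.
Qed.

Lemma estimate_upper s j t : (forall i, sg i t ^+ 2 = 1) ->
  beta j + s < estimate j t ->
  \sum_i @vote_val R (votes s 1 i j t) <= 0.
Proof.
move=> sg2; rewrite /estimate /cw_median => /median_gt_votes.
apply: le_trans; rewrite le_eqVlt; apply/predU1P; left.
apply: eq_bigr => i _; congr (vote_val _); rewrite /vote.
rewrite (norm_sign_mul j (sg2 i)); case: ifP => // h; congr Some.
by rewrite ratio_estimate// lerD2l mul1r ratio_leE// (norm_sign_mul j (sg2 i)).
Qed.

Lemma estimate_lower s j t : (forall i, sg i t ^+ 2 = 1) ->
  estimate j t < beta j - s ->
  \sum_i @vote_val R (votes s (-1) i j t) <= 0.
Proof.
move=> sg2; rewrite /estimate /cw_median => /median_lt_votes.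
apply: le_trans; rewrite le_eqVlt; apply/predU1P; left.
apply: eq_bigr => i _; congr (vote_val _); rewrite /vote.
rewrite (norm_sign_mul j (sg2 i)); case: ifP => // h; congr Some.
rewrite ratio_estimate// lerD2l lerNl -[- (_ / _)]mulNr ratio_leE.
  by rewrite mulN1r mulNr.
by rewrite (norm_sign_mul j (sg2 i)).
Qed.

Lemma measure_exists_le (K : finType) (E : K -> set T) :
  (forall k, measurable (E k)) ->
  (P [set t | exists k, E k t] <= \sum_k P (E k))%E.
Proof.
move=> mE; rewrite (_ : [set t | _] = \big[setU/set0]_k E k); last first.
  rewrite -bigcup_seq; apply/seteqP; split => t /=; last by case=> k _; exists k.
  by case=> k Ek; exists k => //=; rewrite mem_index_enum.
have : measurable (\big[setU/set0]_k E k) /\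
    (P (\big[setU/set0]_k E k) <= \sum_k P (E k))%E.
  elim/big_rec2: _ => [|k x A _ [mA PA]]; first by rewrite measure0.
  split; first exact: measurableU.
  by apply: (@le_trans _ _ (P (E k) + P A)%E); [exact: measureU2|exact: leeD2l].
by case.
Qed.

Lemma sign_null i : P [set t | sg i t ^+ 2 != 1] = 0%E.
Proof.
have [sg1 sgN1] := lsg i.
rewrite -(rademacher_null (@measurable_coords (inr (inr i))) sg1 sgN1).
congr (P _); apply/seteqP; split => t /=; rewrite sqrf_eq1.
  by move=> /norP[h1 h2] [/eqP|/eqP]; apply/negP.
move=> h; apply/norP; split; apply/eqP => h'; apply: h; [by left|by right].
Qed.

Lemma measurable_vote_sum (s eps : R) j :
  measurable [set x | \sum_i @vote_val R (votes s eps i j x) <= 0].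
Proof.
pose f x := [ffun i => votes s eps i j x].
pose Q (a : {ffun 'I_n -> option bool}) := \sum_i @vote_val R (a i) <= 0.
have QE x : Q (f x) = (\sum_i @vote_val R (votes s eps i j x) <= 0).
  by rewrite /Q; under eq_bigr do rewrite ffunE.
rewrite (_ : [set x | _] = [set x | Q (f x)]); last first.
  by apply/seteqP; split => x /=; rewrite QE.
apply: measurable_finite_pred => a.
rewrite (_ : [set x | _] = [set x | forall i, [set x | votes s eps i j x = a i] x]).
  apply: measurable_forall => i; apply: measurable_vote => //.
  exact: measurable_residualT.
apply/seteqP; split => x /=; first by move=> <- i; rewrite ffunE.
by move=> h; apply/ffunP => i; rewrite ffunE.
Qed.

Lemma coordinatewise_median_error tau : 0 < tau -> tau <= alpha ^+ 2 * n%:R ->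
  ((1 - 2 * expR (ln d%:R - kappa ^+ 4 / 8 * tau))%:E <=
   P [set t | (\sum_(j < d) (beta j - estimate j t) ^+ 2 <=
     d%:R * tau / (alpha ^+ 2 * n%:R) * (1 + \sum_(j < d) beta j ^+ 2))%R])%E.
Proof.
move=> tau0 tau_le.
have an0 : 0 < alpha ^+ 2 * n%:R by exact: lt_le_trans tau_le.
(* Chosen so that d times the square of the threshold [t * beta_scale] is the claimed error
   bound. *)
pose t := Num.sqrt (tau / (alpha ^+ 2 * n%:R)).
have t0 : 0 <= t by exact: sqrtr_ge0.
have t2 : t ^+ 2 = tau / (alpha ^+ 2 * n%:R) by rewrite sqr_sqrtr// divr_ge0// ltW.
have t1 : t <= 1.
  by rewrite -(@ler_pXn2r _ 2)// ?nnegrE// expr1n t2 ler_pdivrMr// mul1r.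
have s2 : (t * beta_scale) ^+ 2 =
    tau / (alpha ^+ 2 * n%:R) * (1 + \sum_(j < d) beta j ^+ 2).
  rewrite exprMn t2 sqr_sqrtr// addr_ge0// sumr_ge0// => l _; exact: sqr_ge0.
have s0 : 0 <= t * beta_scale by rewrite mulr_ge0 ?sqrtr_ge0.
pose eps (b : bool) : R := if b then 1 else -1.
have eps2 b : eps b ^+ 2 = 1 by case: b; rewrite /eps ?sqrrN expr1n.
(* Bad events: a sign outside 1 and -1, of probability 0, and a lost vote for each coordinate and
   each side. *)
pose E (k : 'I_n + 'I_d * bool) := match k with
  | inl i => [set x | sg i x ^+ 2 != 1]
  | inr jb => [set x | \sum_i @vote_val R (votes (t * beta_scale) (eps jb.2) i jb.1 x) <= 0]
  end.
have mE k : measurable (E k).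
  case: k => [i|[j b]] /=.
    apply: measurable_bool_set; apply: measurable_neg; apply: measurable_fun_eqr => //.
    exact: measurable_funX.
  exact: measurable_vote_sum.
set G := [set x | _].
have mG : measurable G.
  apply: measurable_bool_set; apply: measurable_fun_ler => //.
  apply: measurable_sum => j; apply: measurable_funX; apply: measurable_funB => //.
  exact: measurable_estimate.
have PG : (P [set x | exists k, E k x] <=
    (2 * (d%:R * expR (- (kappa ^+ 4 / 8 * tau))))%:E)%E.
  apply: le_trans (measure_exists_le mE) _.
  rewrite big_sumType/= big1 ?add0e => [|i _]; last exact: sign_null.
  apply: (@le_trans _ _ (\sum_(jb : 'I_d * bool) (expR (- (kappa ^+ 4 / 8 * tau)))%:E)%E).
    apply: lee_sum => -[j b] _ /=.
    rewrite -[leLHS]fineK ?fin_num_measure//; last exact: (mE (inr (j, b))).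
    rewrite lee_fin; apply: le_trans (vote_sum_tail j t0 t1 (eps2 b)) _.
    by rewrite t2 [X in kappa ^+ 4 / 8 * X]mulrC divfK ?gt_eqF.
  rewrite sumEFin lee_fin sumr_const card_prod card_ord card_bool.
  by rewrite -[leLHS]mulr_natl natrM [_ * 2%:R]mulrC mulrA.
have GE : ~` [set x | exists k, E k x] `<=` G.
  move=> x nE.
  have sg2 i : sg i x ^+ 2 = 1.
    by apply/eqP; apply: contra_notT nE => h; exists (inl i).
  have err j : `|beta j - estimate j x| <= t * beta_scale.
    rewrite ler_norml; apply/andP; split; rewrite leNgt; apply/negP => h; apply: nE.
      exists (inr (j, true)) => /=; apply: estimate_upper => //; lra.
    exists (inr (j, false)) => /=; apply: estimate_lower => //; lra.
  rewrite /G /=.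
  apply: (@le_trans _ _ (\sum_(j < d) (t * beta_scale) ^+ 2)).
    apply: ler_sum => j _; rewrite -(real_normK (num_real (_ - _))).
    by rewrite ler_sqr ?nnegrE.
  by rewrite sumr_const card_ord s2 -[leLHS]mulr_natl !mulrA.
have mB : measurable [set x | exists k, E k x].
  rewrite (_ : [set x | _] = \bigcup_(k in [set: _]) E k).
    by apply: fin_bigcup_measurable => //; exact: finite_finset.
  by apply/seteqP; split => x /=; [case=> k ?; exists k|case=> k _ ?; exists k].
apply: (@le_trans _ _ (P (~` [set x | exists k, E k x]))); last first.
  by apply: le_measure; rewrite ?inE//; exact: measurableC.
rewrite probability_setC// EFinB leeD2l// leeN2; apply: le_trans PG _.
rewrite lee_fin ler_wpM2l//.
(* For [d = 0] the exponential does not invert [ln], but the union bound is then 0. *)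
case: (posnP d) => [->|d0]; first by rewrite mul0r expR_ge0.
by rewrite exp.expRD lnK// posrE ltr0n.
Qed.

End coordinatewise_median.

Theorem mainTheorem14 :
  exists c : Rdefinitions.R, 0 < c /\
  forall (n d : nat) (dT : measure_display) (T : measurableType dT)
    (P : probability T Rdefinitions.R)
    (X : 'I_n -> 'I_d -> {RV P >-> (Rdefinitions.R : realType)})
    (w sg : 'I_n -> {RV P >-> (Rdefinitions.R : realType)})
    (beta : 'I_d -> Rdefinitions.R) (eta : 'I_n -> Rdefinitions.R)
    (alpha tau : Rdefinitions.R),
    (* entries of X i.i.d. N(0,1) *)
    (forall i j A, measurable A -> P (X i j @^-1` A) = normal_prob 0 1 A) ->
    (* algorithm's Gaussian noise w_i ~ N(0,1) *)
    (forall i A, measurable A -> P (w i @^-1` A) = normal_prob 0 1 A) ->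
    (* algorithm's Rademacher signs *)
    (forall i, P (sg i @^-1` [set 1]) = (1 / 2)%:E /\
               P (sg i @^-1` [set -1]) = (1 / 2)%:E) ->
    (* all of X, w, sg mutually independent *)
    mutually_independent P
      (fun k : ('I_n * 'I_d) + ('I_n + 'I_n) =>
         match k with
         | inl ij => (X ij.1 ij.2 : T -> Rdefinitions.R)
         | inr (inl i) => (w i : T -> Rdefinitions.R)
         | inr (inr i) => (sg i : T -> Rdefinitions.R)
         end) ->
    0 < alpha -> alpha <= 1 ->
    alpha * n%:R <= #|[pred i : 'I_n | `|eta i| <= 1]|%:R ->
    0 < tau -> tau <= alpha ^+ 2 * n%:R ->
    ((1 - 2 * expR (ln d%:R - c * tau))%:E <=
     P [set t : T |
        (let y := fun i => \sum_(j < d) X i j t * beta j + eta i in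
        let bh := cw_median y (fun i j => X i j t) (fun i => w i t)
                            (fun i => sg i t) in
        \sum_(j < d) (beta j - bh j) ^+ 2 <=
          d%:R * tau / (alpha ^+ 2 * n%:R) * (1 + \sum_(j < d) beta j ^+ 2))%R])%E.
Proof.
exists (@normal_lower_const Rdefinitions.R ^+ 4 / 8); split.
  by rewrite divr_gt0// exprn_gt0// normal_lower_const_gt0.
move=> n d dT T P X w sg beta eta alpha tau lX lw lsg indF a0 a1 good tau0 tau_le.
exact: (@coordinatewise_median_error _ _ _ P n d X w sg beta eta lX lw lsg indF
  alpha a0 a1 good tau tau0 tau_le).
Qed.
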